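(* Assume Martin's Axiom. Let $K$ be a continuum of weight less than $\mathfrak{c}$. Then $K$ is a continuous image of $\mathbb{H}^*$.
   Context: A continuum is a (nonempty) compact connected Hausdorff space. The weight of a space is the least cardinality of a base for its topology, and $\mathfrak{c}=2^{\aleph_0}$. $\mathbb{H}=[0,\infty)$ is the half line with its usual topology, and $\mathbb{H}^*=\beta\mathbb{H}\setminus\mathbb{H}$ is its Čech–Stone remainder. Martin's Axiom is the statement that for every partial order satisfying the countable chain condition and every family of fewer than $\mathfrak{c}$ dense subsets of it there is a filter meeting all members of the family. *)

(* Defs.v *)
From HB Require Import structures.
From mathcomp Require Import all_boot all_order all_algebra.
From mathcomp Require Import all_classical all_reals all_analysis.

Set Implicit Arguments.
Unset Strict Implicit.
Unset Printing Implicit Defensive.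

Import Order.TTheory GRing.Theory Num.Theory.
Import numFieldNormedType.Exports.

Local Open Scope classical_set_scope.
Local Open Scope ring_scope.
Local Open Scope card_scope.

Definition card_lt T U (A : set T) (B : set U) : Prop :=
  A #<= B /\ ~ (B #<= A).

Definition lt_continuum T (A : set T) : Prop := card_lt A [set: set nat].

Section MartinAxiom.
Context {d : Order.disp_t} {P : porderType d}.
Implicit Types A D G : set P.

(* The forcing convention: stronger conditions are smaller. *)
Definition compatible (p q : P) : Prop :=
  exists2 r : P, (r <= p)%O & (r <= q)%O.

Definition antichain A : Prop :=
  forall p q, A p -> A q -> p <> q -> ~ compatible p q.

Definition poset_dense D : Prop :=
  forall p, exists2 q, D q & (q <= p)%O.

Definition poset_filter G : Prop :=
  [/\ G !=set0,
      (forall p q, G p -> (p <= q)%O -> G q) &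
      (forall p q, G p -> G q -> exists r, [/\ G r, (r <= p)%O & (r <= q)%O])].

End MartinAxiom.

Definition countable_chain_condition d (P : porderType d) : Prop :=
  forall A : set P, antichain A -> countable A.

(* Partial orders are taken to be nonempty: filters are nonempty, so the
   empty order would refute the axiom. *)
Definition martin_axiom : Prop :=
  forall (d : Order.disp_t) (P : porderType d),
    [set: P] !=set0 ->
    countable_chain_condition P ->
    forall F : set (set P),
      lt_continuum F ->
      (forall D, F D -> poset_dense D) ->
      exists2 G : set P, poset_filter G & forall D, F D -> G `&` D !=set0.

Definition continuum (K : topologicalType) : Prop :=
  [/\ [set: K] !=set0, compact [set: K], connected [set: K]
    & hausdorff_space K].

(* The weight of [T] is the cardinality of any [B] with [min_basis B]. *)
Definition min_basis (T : topologicalType) (B : set (set T)) : Prop :=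
  basis B /\ forall B' : set (set T), basis B' -> B #<= B'.

Definition weight_lt_continuum (T : topologicalType) : Prop :=
  exists2 B : set (set T), min_basis B & lt_continuum B.

Definition unit_interval (R : realType) : set R := [set` `[0, 1]].

Definition half_line (R : realType) : set R := [set` `[0, +oo[].

Arguments unit_interval R : clear implicits.
Arguments half_line R : clear implicits.

Section StoneCech.
Variables (R : realType) (X : topologicalType).

Definition cube : topologicalType :=
  {ptws continuousType X (unit_interval R) -> unit_interval R}.

Definition stone_cech_map : X -> cube :=
  join_product (fun f : continuousType X (unit_interval R) =>
                  (f : X -> unit_interval R)).

(* The compactification beta X (for Tychonoff X) is the closure of the image of
   X in the cube [0, 1] ^ C(X, [0, 1]), with the subspace topology. *)
Definition stone_cech : set cube := closure (range stone_cech_map).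

Definition stone_cech_remainder : set cube :=
  stone_cech `\` range stone_cech_map.

End StoneCech.

Arguments cube R X : clear implicits.
Arguments stone_cech R X : clear implicits.
Arguments stone_cech_remainder R X : clear implicits.

Definition half_line_remainder (R : realType) : topologicalType :=
  set_type (stone_cech_remainder R (half_line R)).
Arguments half_line_remainder R : clear implicits.

Definition continuous_image (X Y : topologicalType) : Prop :=
  exists2 f : X -> Y, continuous f & range f = [set: Y].

(* Main.v *)
From HB Require Import structures.
Require Import Defs.
From mathcomp Require Import all_boot all_order all_algebra.
From mathcomp Require Import all_classical all_reals all_analysis.
From mathcomp Require Import lra zify.

(** Fix a point x0 of K.  A basis of fewer than continuum many open sets gives
    a family of functions phi_j : K -> [0, 1], indexed by pairs of basic sets,
    which vanish at x0 and separate points (bump_functions).  It suffices to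
    find continuous functions f_j on the half line such that, for every finite
    set of indices and every e > 0, the tuple (f_j t) is within e of the image
    of K under (phi_j) for all large t, and comes within e of the image of each
    point of K for arbitrarily large t.  The f_j are coordinates of the cube
    containing the Stone-Cech compactification, so projecting to them maps the
    remainder, which is the intersection of the closures of the tails
    (half_line_remainderE), into the image of K by the first property and, by
    compactness, onto it by the second (remainder_onto).

    The f_j are piecewise linear interpolations of sequences a_j : nat -> R, so
    only a discrete walk in the cube is needed: its steps tend to zero and it
    approaches K in every finite set of coordinates (generic_walk).  Martin's
    Axiom is applied to the finite approximations of such a walk: finitely many
    rational values for finitely many coordinates, with a promise to move in
    steps smaller than e and to stay e-close to K from then on.  The key device
    is that every approximation ends at x0, where all coordinates are 0.  It
    makes approximations of the same length which agree on their common
    coordinates compatible without any further walking, whereas from two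
    different end points one might have to move through the fibre product of
    two projections of K, which need not be connected.  Connectedness of K is
    used only for density: a promise can be kept while visiting a given point of
    K, because every point lies on a loop of small steps based at x0
    (loop_through).

    The order is in fact sigma-centered.  There are at most continuum many
    indices, so they are coded by sets of naturals; the finitely many indices
    of an approximation are told apart by finite parts of their codes, and there
    are countably many patterns labelling such parts with rational values.  Two
    approximations with the same pattern agree on common coordinates.

    One cardinality fact is required: if the basis has fewer than continuum
    many members, so does the set of pairs of members.  Martin's Axiom proves
    this through domination (martin_dominating): if I x J mapped onto
    nat -> nat, each row would be dominated by one function, and these
    functions, one for each element of I, by a single one. *)

Set Implicit Arguments.
Unset Strict Implicit.
Unset Printing Implicit Defensive.

Import Order.TTheory GRing.Theory Num.Theory.
Import numFieldNormedType.Exports.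

Local Open Scope classical_set_scope.
Local Open Scope ring_scope.
Local Open Scope card_scope.

(** * Martin's Axiom for preorders *)

Section Cones.
Variables (P : Type) (le : P -> P -> Prop).
Hypotheses (le_refl : forall p, le p p)
           (le_trans : forall q p r, le p q -> le q r -> le p r).

Let cone (p : P) : set P := [set q | le q p].

(** Antisymmetry is obtained by replacing a condition by the set of its
    extensions, ordered by inclusion. *)
Definition cones : Type := {A : set P | `[< exists p, A = cone p >]}.

HB.instance Definition _ := Choice.on cones.

Definition cones_le (A B : cones) : bool := `[< val A `<=` val B >].

Lemma cones_le_refl : reflexive cones_le.
Proof. by move=> A; apply/asboolP. Qed.

Lemma cones_le_anti : antisymmetric cones_le.
Proof.
move=> A B /andP[/asboolP AB /asboolP BA]; apply: val_inj.
by apply/seteqP.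
Qed.

Lemma cones_le_trans : transitive cones_le.
Proof.
by move=> B A C /asboolP AB /asboolP BC; apply/asboolP; exact: subset_trans BC.
Qed.

HB.instance Definition _ := @Order.Le_isPOrder.Build Order.default_display cones
  cones_le cones_le_refl cones_le_anti cones_le_trans.

Definition cone_of (p : P) : cones :=
  exist _ (cone p) (introT (asboolP (exists q, cone p = cone q)) (ex_intro _ p erefl)).

Lemma cone_ofP (A : cones) : exists p, A = cone_of p.
Proof.
have /asboolP[p Ap] := valP A; exists p; exact: val_inj.
Qed.

Lemma cone_of_le p q : (cone_of p <= cone_of q)%O <-> le p q.
Proof.
split => [/asboolP/(_ p)|pq]; first exact.
by apply/asboolP => r /=; rewrite /cone /= => rp; exact: le_trans pq.
Qed.

(** The countable chain condition comes from [shape], whose values colour the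
    conditions with countably many colours so that conditions of one colour are
    compatible: [shape] is then injective on any antichain. *)
Lemma martin_axiom_centered (shape : P -> nat) (I : Type) (D : I -> set P) :
  martin_axiom -> [set: P] !=set0 ->
  (forall p q, shape p = shape q -> exists2 r, le r p & le r q) ->
  lt_continuum [set: I] ->
  (forall i p, exists2 q, D i q & le q p) ->
  exists G : set P,
    (forall p q, G p -> G q -> exists r, [/\ G r, le r p & le r q]) /\
    (forall i, exists2 p, G p & D i p).
Proof.
move=> MA [p0 _] cent [ltI geI] dD.
pose DD i : set cones := [set A | exists2 p, A = cone_of p & D i p].
have [|||_ [i _ <-]|G [_ _ Gdir] GD] :=
  MA _ cones _ _ (range DD).
- by exists (cone_of p0).
- move=> A antiA.
  have [rep repP] : {rep : cones -> P & forall B, B = cone_of (rep B)}.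
    by exists (fun B => sval (cid (cone_ofP B))) => B; case: cid.
  apply/countable_injP; exists (shape \o rep) => B C.
  move=> /set_mem AB /set_mem AC /= /cent[r rB rC].
  apply: contrapT => BC; apply: (antiA _ _ AB AC BC); exists (cone_of r).
    by rewrite [B]repP; apply/cone_of_le.
  by rewrite [C]repP; apply/cone_of_le.
- split; first exact: card_le_trans (card_image_le _ _) ltI.
  by move=> /card_le_trans H; apply: geI; apply: H; exact: card_image_le.
- move=> A; have [p ->] := cone_ofP A; have [q Dq qp] := dD i p.
  by exists (cone_of q); [exists q|apply/cone_of_le].
exists [set p | G (cone_of p)]; split => [p q Gp Gq|i].
  have [A [GA]] := Gdir _ _ Gp Gq; have [r Ar] := cone_ofP A; rewrite Ar in GA *.
  by move=> /cone_of_le ? /cone_of_le ?; exists r.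
have [A [GA [p Ap Dp]]] := GD (DD i) (imageT _ _).
by exists p => //=; rewrite -Ap.
Qed.

End Cones.

(** * Sets of size less than the continuum *)

Lemma lt_continuum_missed (I : Type) (g : I -> set nat) :
  lt_continuum [set: I] -> exists A, forall i, g i <> A.
Proof.
move=> [_ nI]; apply: contrapT => nA; apply: nI.
apply/pcard_surjP; exists g => A _; apply: contrapT => ni; apply: nA.
by exists A => i gi; apply: ni; exists i.
Qed.

(** The diagonal arguments below run in a convenient [X] instead of [set nat];
    the injection [c] gives the weak inequality. *)
Lemma lt_continuumI (I X : Type) (c : I -> set nat) (t : set nat -> X) :
  injective c -> (forall x, exists A, t A = x) ->
  (forall g : I -> X, exists x, forall i, g i <> x) ->
  lt_continuum [set: I].
Proof.
move=> injc surjt miss; split.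
  by apply/pcard_injP; exists c => x y _ _; exact: injc.
move=> /pcard_surjP[g gs]; have [x nx] := miss (t \o g).
by have [A Ax] := surjt x; have [i _ gi] := gs A Logic.I; apply: (nx i); rewrite /= gi.
Qed.

Lemma lt_continuum_inj (I : Type) : lt_continuum [set: I] ->
  exists c : I -> set nat, injective c.
Proof.
by move=> [/pcard_injP[c cinj] _]; exists c => x y; apply: cinj; rewrite in_setT.
Qed.

(** A set of codes of pairs is read as a sequence of sets, so that such sequences
    are no more numerous than the sets of naturals. *)
Local Definition section (A : set nat) (n : nat) : set nat :=
  [set k | A (pickle (n, k))].

Local Lemma section_surj (u : nat -> set nat) : exists A, section A = u.
Proof.
exists [set m | exists n k, m = pickle (n, k) /\ u n k].
apply/funext => n; apply/seteqP; split => k /=.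
  by move=> [n' [k' [/(pcan_inj pickleK)[-> ->]]]].
by move=> unk; exists n, k.
Qed.

Local Definition pair_code I J (c : I -> set nat) (d : J -> set nat)
    (x : I * J) : set nat :=
  [set m | exists k, m = pickle (true, k) /\ c x.1 k \/
                     m = pickle (false, k) /\ d x.2 k].

Local Lemma pair_code_inj I J (c : I -> set nat) (d : J -> set nat) :
  injective c -> injective d -> injective (pair_code c d).
Proof.
move=> ci di [i j] [i' j'] /seteqP[/= s1 s2]; congr pair.
- apply: ci; apply/seteqP; split => k ck.
  + have [|k' [[/(pcan_inj pickleK)[<-]]|[/(pcan_inj pickleK)]]] // :=
      s1 (pickle (true, k)).
    by exists k; left.
  + have [|k' [[/(pcan_inj pickleK)[<-]]|[/(pcan_inj pickleK)]]] // :=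
      s2 (pickle (true, k)).
    by exists k; left.
- apply: di; apply/seteqP; split => k ck.
  + have [|k' [[/(pcan_inj pickleK)]|[/(pcan_inj pickleK)[<-]]]] // :=
      s1 (pickle (false, k)).
    by exists k; right.
  + have [|k' [[/(pcan_inj pickleK)]|[/(pcan_inj pickleK)[<-]]]] // :=
      s2 (pickle (false, k)).
    by exists k; right.
Qed.

(** König's diagonal argument: the [n]-th coordinates of the sequences
    [g (i, n)] miss some set [x n], so the sequence [x] is missed by [g]. *)
Lemma lt_continuum_prod_nat (I : Type) :
  lt_continuum [set: I] -> lt_continuum [set: I * nat].
Proof.
move=> smallI; have [c cinj] := lt_continuum_inj smallI.
apply: (@lt_continuumI _ _ (pair_code c (@set1 nat)) section) => [||g].
- by apply: pair_code_inj => // m n /seteqP[/(_ m erefl) ->].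
- exact: section_surj.
have /choice[x xP] n : exists x, forall i, g (i, n) n <> x.
  exact: lt_continuum_missed smallI.
by exists x => -[i n] gx; apply: (xP n i); rewrite gx.
Qed.

(** A condition is a finite initial segment of a dominating function together
    with a function that all later values must lie above.  Conditions with
    the same finite segment are compatible, by taking the maximum of the two
    functions. *)
Section Domination.

Let cond : Type := (seq nat * (nat -> nat))%type.

Let ext (q p : cond) : Prop :=
  [/\ (size p.1 <= size q.1)%N,
      forall i, (i < size p.1)%N -> nth 0%N q.1 i = nth 0%N p.1 i,
      forall i, (p.2 i <= q.2 i)%N &
      forall i, (size p.1 <= i < size q.1)%N -> (p.2 i <= nth 0%N q.1 i)%N].

Let ext_refl p : ext p p.
Proof. by split => // i; case: leqP => // _ /=; case: leqP. Qed.

Let ext_trans q p r : ext p q -> ext q r -> ext p r.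
Proof.
move=> [qp eqp leqp geqp] [rq erq lerq gerq]; split => [|i ir|i|i /andP[ri ip]].
- exact: leq_trans rq qp.
- by rewrite eqp ?erq // (leq_trans ir).
- exact: leq_trans (lerq i) (leqp i).
- have [iq|qi] := ltnP i (size q.1).
    by rewrite eqp // gerq // ri.
  by rewrite (leq_trans (lerq i)) // geqp // qi.
Qed.

Lemma martin_dominating (I : Type) (h : I -> nat -> nat) :
  martin_axiom -> lt_continuum [set: I] ->
  exists g : nat -> nat,
    forall i, exists N, forall n, (N <= n)%N -> (h i n <= g n)%N.
Proof.
move=> MA smallI.
pose D (x : I * nat) : set cond :=
  [set p | (forall k, (h x.1 k <= p.2 k)%N) /\ (x.2 <= size p.1)%N].
have [|p q /(pcan_inj pickleK) pq|[i n] [s g]|G [Gdir GD]] :=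
  martin_axiom_centered ext_refl ext_trans (shape := fun p => pickle p.1)
    (D := D) MA _ _ (lt_continuum_prod_nat smallI).
- by exists ([::], fun=> 0%N).
- have empty_range k : (size p.1 <= k < size p.1)%N -> False.
    by case/andP => + kp; rewrite leqNgt kp.
  exists (p.1, fun k => maxn (p.2 k) (q.2 k)); split => //=; rewrite -?pq // => k.
  + exact: leq_maxl.
  + by move/empty_range.
  + exact: leq_maxr.
  + by move/empty_range.
- exists (mkseq (fun k => if (k < size s)%N then nth 0%N s k else g k)
    (maxn (size s) n), fun k => maxn (g k) (h i k)).
    by rewrite /D /= size_mkseq leq_maxr; split => // k; exact: leq_maxr.
  split => /=; rewrite ?size_mkseq ?leq_maxl // => k.
  + by move=> ks; rewrite nth_mkseq ?ks // leq_max ks.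
  + by rewrite leq_maxl.
  + by move=> /andP[sk kn]; rewrite nth_mkseq // ltnNge sk.
(* Unless [I] is empty, [G] decides every value and the default is not taken. *)
pose g n := xget 0%N [set k | exists2 p, G p & (n < size p.1)%N /\ nth 0%N p.1 n = k].
have gE p n : G p -> (n < size p.1)%N -> g n = nth 0%N p.1 n.
  move=> Gp np; rewrite /g; case: xgetP => [k -> [q Gq [nq <-]]|/(_ (nth 0%N p.1 n))].
    by have [r [_ [_ rp _ _] [_ rq _ _]]] := Gdir p q Gp Gq; rewrite -rp // -rq.
  by case; exists p.
exists g => i; have [p Gp [/= hp _]] := GD (i, 0%N).
exists (size p.1) => n pn; have [q Gq [_ /= nq]] := GD (i, n.+1).
have [r [Gr [_ _ _ rp] [qr _ _ _]]] := Gdir p q Gp Gq.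
have nr : (n < size r.1)%N by exact: leq_trans qr.
by rewrite (gE r) // (leq_trans (hp n)) // rp // pn.
Qed.
End Domination.

Local Definition code_fun (A : set nat) (n : nat) : nat :=
  xget 0%N [set k | A (pickle (n, k))].

Local Lemma code_fun_surj (f : nat -> nat) : exists A, code_fun A = f.
Proof.
exists [set m | exists n, m = pickle (n, f n)].
apply/funext => n; rewrite /code_fun; case: xgetP => [k ->|/(_ (f n))].
  by move=> [n' /(pcan_inj pickleK)[-> ->]].
by case; exists n.
Qed.

(** Domination first bounds each row [h (i, _)] and then the bounds of all rows;
    the successor of the final bound is therefore missed by [h]. *)
Lemma lt_continuum_prod (I J : Type) : martin_axiom ->
  lt_continuum [set: I] -> lt_continuum [set: J] -> lt_continuum [set: I * J].
Proof.
move=> MA smallI smallJ.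
have [c cinj] := lt_continuum_inj smallI.
have [d dinj] := lt_continuum_inj smallJ.
apply: (@lt_continuumI _ _ (pair_code c d) code_fun) => [||h].
- exact: pair_code_inj.
- exact: code_fun_surj.
have /choice[row rowP] i := martin_dominating (fun j => h (i, j)) MA smallJ.
have [g gP] := martin_dominating row MA smallI.
exists (fun n => (g n).+1) => -[i j] hE.
have [M rowM] := rowP i j; have [N gN] := gP i.
have := leq_trans (rowM (maxn M N) (leq_maxl _ _)) (gN (maxn M N) (leq_maxr _ _)).
by rewrite hE ltnn.
Qed.

(** * Loops of small steps in a connected space *)

(** The value [f 0 = 0] is what lets walks begin and end at the exact position
    [0] of the base point. *)
Lemma rat_approximation (R : realType) (e : R) : 0 < e ->
  exists f : R -> rat, f 0 = 0 /\ forall r, `|ratr (f r) - r| < e.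
Proof.
move=> e0.
have /choice[f fP] r : exists q : rat, `|ratr q - r| < e.
  have /rat_in_itvoo[q] : r - e < r + e by lra.
  by rewrite in_itv /= => /andP[? ?]; exists q; rewrite ltr_distl; apply/andP.
exists (fun r => if r == 0 then 0 else f r); rewrite eqxx; split => // r.
by case: eqVneq => [->|_]; rewrite ?rmorph0 ?subrr ?normr0.
Qed.

Section Loops.
Variables (R : realType) (K : topologicalType) (J : eqType).
Variables (phi : J -> K -> R) (x0 : K).
Hypothesis phi_cts : forall j, continuous (phi j).
Hypothesis K_conn : connected [set: K].

Lemma fin_close_nbhs (S : seq J) (e : R) (y : K) : 0 < e ->
  \forall z \near y, forall j, j \in S -> `|phi j z - phi j y| < e.
Proof.
move=> e0; elim: S => [|i S IH]; first by near=> z.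
have h : \forall z \near y, `|phi i z - phi i y| < e.
  have /cvgr_dist_lt/(_ e e0) := @phi_cts i y.
  by apply: filterS => z; rewrite distrC.
near=> z => j; rewrite in_cons => /predU1P[->|]; first by near: z.
by move: j; near: z.
Unshelve. all: by end_near. Qed.

(** The points lying on some loop of [e]-small steps based at [x0] form a clopen
    set: a point [z'] close to a point [z] of a loop is added to it as the
    detour [z, z', z].  The parameter [n] delays the visit by resting at
    [x0]. *)
Lemma loop_through (S : seq J) (e : R) (y : K) (n : nat) : 0 < e ->
  exists (w : nat -> K) (L k : nat),
  [/\ w 0%N = x0, forall i, (L <= i)%N -> w i = x0, (n <= k < L)%N, w k = y &
      forall i j, j \in S -> `|phi j (w i.+1) - phi j (w i)| < e].
Proof.
move=> e0.
pose loop y := exists (w : nat -> K) (L k : nat),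
  [/\ w 0%N = x0, forall i, (L <= i)%N -> w i = x0, (k < L)%N, w k = y &
      forall i j, j \in S -> `|phi j (w i.+1) - phi j (w i)| < e].
suff [w [L [k [w0 wL kL wk wS]]]] : loop y.
  exists (fun i => w (i - n)%N), (L + n)%N, (k + n)%N; split => //.
  - by move=> i Li; rewrite wL // leq_subRL ?(leq_trans _ Li) ?leq_addl // addnC.
  - by rewrite leq_addl ltn_add2r.
  - by rewrite addnK.
  - move=> i j jS; have [ni|ni] := leqP n i; first by rewrite subSn // wS.
    by rewrite (eqP ni) (eqP (ltnW ni)) subrr normr0.
have loop_step z z' : loop z ->
    (forall j, j \in S -> `|phi j z' - phi j z| < e) -> loop z'.
  move=> [w [L [k [w0 wL kL wk wS]]]] zz'.
  exists (fun i => if (i <= k)%N then w i else if i == k.+1 then z' else w i.-2),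
    L.+2, k.+1; split => //.
  - move=> i Li; have ki : (k.+2 < i)%N by exact: leq_ltn_trans Li.
    have -> : (i <= k)%N = false by lia.
    have -> : (i == k.+1) = false by lia.
    by rewrite wL //; lia.
  - by lia.
  - by rewrite ltnn eqxx.
  - move=> i j jS; have [ik|[->|ki]] : (i < k \/ i = k \/ k < i)%N by lia.
    + by rewrite ik (ltnW ik) wS.
    + by rewrite ltnn eqxx leqnn wk zz'.
    + have -> : (i < k)%N = false by lia.
      have -> : (i <= k)%N = false by lia.
      have -> : (i.+1 == k.+1) = false by lia.
      have [->|ik] := eqVneq i k.+1; first by rewrite /= wk distrC zz'.
      by case: i ki ik => [|[|i]] ki ik; [lia|lia|exact: wS].
suff : loop = [set: K] by move/seteqP => -[_]; apply.
apply: K_conn.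
- by exists x0, (fun=> x0), 1%N, 0%N; split => // i j _; rewrite subrr normr0.
- exists loop; rewrite ?setTI //; rewrite openE => z lz.
  by apply: filterS (fin_close_nbhs S z e0) => z' /(loop_step _ _ lz).
- exists loop; rewrite ?setTI // => z clz.
  have [z' [lz' zz']] := clz _ (fin_close_nbhs S z e0).
  by apply: loop_step lz' _ => j jS; rewrite distrC zz'.
Qed.

End Loops.

(** * The generic walk *)

Section Separation.
Variables (J : eqType) (c : J -> set nat).
Hypothesis c_inj : injective c.

Definition trace (N : nat) (j : J) : seq bool := mkseq (fun i => `[< c j i >]) N.

(** The initial parts of the codes serve as labels of the indices in the
    countably many patterns of finite walks. *)
Lemma trace_separates (S : seq J) :
  exists N, {in S &, injective (trace N)}.
Proof.
have /choice[d dP] (x : J * J) :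
    exists n, x.1 <> x.2 -> `[< c x.1 n >] <> `[< c x.2 n >].
  apply: contrapT => /forallNP same.
  have /c_inj xE : c x.1 = c x.2.
    apply/funext => n; have /not_implyP[_ /contrapT h] := same n.
    by apply/propext; split => cn; apply/asboolP; [rewrite -h|rewrite h]; apply/asboolP.
  by apply: (same 0%N).
exists (\max_(x <- [seq (i, j) | i <- S, j <- S]) d x).+1 => i j iS jS ij.
apply: contrapT => /(dP (i, j)); apply => /=.
move: (congr1 (nth false ^~ (d (i, j))) ij); rewrite !nth_mkseq // ltnS;
  by apply: leq_bigmax_seq => //; exact: allpairs_f.
Qed.

End Separation.

Section Generic.
Variables (R : realType) (K : topologicalType) (J : eqType).
Variables (phi : J -> K -> R) (x0 : K).
Hypothesis phi_cts : forall j, continuous (phi j).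
Hypothesis phi_x0 : forall j, phi j x0 = 0.
Hypothesis K_conn : connected [set: K].

(** A finite approximation of the walk.  Only the entries at times below [len] in
    the coordinates from [coords] are meaningful; two records that differ
    elsewhere are equivalent in the extension preorder. *)
Record partial_walk := PartialWalk {
  len : nat;
  coords : seq J;
  entries : J -> nat -> rat;
  precision : nat }.

Let eps (p : partial_walk) : R := (precision p).+1%:R^-1.

(** From time [len p] on the position is read as 0, the base point, so that every
    approximation ends there. *)
Let pos (p : partial_walk) (j : J) (k : nat) : R :=
  if (k < len p)%N then ratr (entries p j k) else 0.

(** The steps of [q] at the times before [len p] are those of [p]; at the later
    times [q] must keep the promise of [p], in the coordinates of [p] only.
    Agreement is required at time [len p] too, so that the extension starts from
    the base point. *)
Let ext (q p : partial_walk) : Prop :=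
  [/\ (len p <= len q)%N /\ (precision p <= precision q)%N,
      {subset coords p <= coords q},
      forall j k, j \in coords p -> (k <= len p)%N -> pos q j k = pos p j k &
      forall k, (len p <= k < len q)%N ->
        (exists x, forall j, j \in coords p -> `|pos q j k - phi j x| < eps p) /\
        (forall j, j \in coords p -> `|pos q j k.+1 - pos q j k| < eps p)].

Let eps_le p q : (precision p <= precision q)%N -> eps q <= eps p.
Proof. by move=> pq; rewrite lef_pV2 ?posrE ?ltr0n // ler_nat. Qed.

Let pos_len p j k : (len p <= k)%N -> pos p j k = 0.
Proof. by rewrite /pos ltnNge => ->. Qed.

Let ext_refl p : ext p p.
Proof. by split => // k; case: leqP => // _ /=; case: leqP. Qed.

Let ext_trans q p r : ext p q -> ext q r -> ext p r.
Proof.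
move=> [[lpq mpq] spq apq cpq] [[lqr mqr] sqr aqr cqr]; split.
- by split; [exact: leq_trans lpq|exact: leq_trans mpq].
- by move=> j /sqr/spq.
- by move=> j k jr kr; rewrite apq ?aqr ?sqr // (leq_trans kr).
- move=> k /andP[rk kp]; have [kq|qk] := ltnP k (len q).
    have [|[x xP] sP] := cqr k; first by rewrite rk.
    by split; [exists x|] => j jr; rewrite ?apq ?sqr ?xP ?sP // ltnW.
  have [|[x xP] sP] := cpq k; first by rewrite qk.
  split; [exists x|] => j /sqr jq; apply: lt_le_trans (eps_le mqr).
    exact: xP.
  exact: sP.
Qed.

Let reaches_half (j : J) (p : partial_walk) (n : nat) : Prop :=
  exists k, (n <= k < len p)%N /\ 2^-1 < pos p j k.

(** The visit to a value above [2^-1] at a coordinate reaching the value 1 is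
    enough to bring the walk near any given point: the coordinates of points
    outside a prescribed neighbourhood vanish for a suitable index. *)
Let requirement (x : J * nat) : set partial_walk :=
  [set p | [/\ x.1 \in coords p, (x.2 <= precision p)%N, (x.2 <= len p)%N &
    (exists y, phi x.1 y = 1) -> reaches_half x.1 p x.2]].

(** The extension follows rational approximations of a loop through a point [y]
    where the coordinate [j] equals 1, within a third of the precision, so that
    two approximation errors and one step of the loop add up to less than
    the precision. *)
Let requirement_dense x p : exists2 q, requirement x q & ext q p.
Proof.
case: x => j n.
pose m := maxn (precision p) n.
pose e : R := m.+1%:R^-1.
have e0 : 0 < e by rewrite invr_gt0 ltr0n.
have e1 : e <= 1 by rewrite invf_le1 ?ltr0n // ler1n.
have e3 : 0 < e / 3 by lra.
have [app [app0 appP]] := rat_approximation e3.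
have [y yP] : exists y, (exists y, phi j y = 1) -> phi j y = 1.
  have [[y yP]|ny] := pselect (exists y, phi j y = 1); first by exists y.
  by exists x0 => /ny.
have [w [L [k0 [w0 wL /andP[nk kL] wk wS]]]] :=
  loop_through x0 phi_cts K_conn (j :: coords p) y n e3.
pose q := PartialWalk (len p + L) (j :: coords p)
  (fun i k => if (k < len p)%N then entries p i k
              else app (phi i (w (k - len p)%N))) m.
have posq i k : (len p <= k)%N -> pos q i k = ratr (app (phi i (w (k - len p)%N))).
  move=> pk; rewrite /pos /=; have -> : (k < len p)%N = false by lia.
  by case: ltnP => // qk; rewrite wL ?phi_x0 ?app0 ?rmorph0 //; lia.
exists q.
  split => /=; rewrite ?mem_head ?leq_maxr //; first by lia.
  move=> /yP jy; exists (len p + k0)%N => /=; split; first by lia.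
  rewrite posq ?leq_addr // addKn wk jy.
  have := appP 1; rewrite ltr_distl => /andP[+ _]; lra.
split => /=.
- by rewrite leq_addr leq_maxl.
- by move=> i; rewrite in_cons => ->; rewrite orbT.
- move=> i k _; rewrite leq_eqVlt => /predU1P[->|kp].
    by rewrite posq // subnn w0 phi_x0 app0 rmorph0 pos_len.
  by rewrite /pos kp /= kp (leq_trans kp) // leq_addr.
- have ep : e <= eps p by exact: (@eps_le p q (leq_maxl _ _)).
  move=> k /andP[pk kq]; split; [exists (w (k - len p)%N)|] => i ip.
    by rewrite posq //; apply: lt_le_trans (appP _) _; lra.
  rewrite !posq ?(leqW pk) // subSn //.
  have := wS (k - len p)%N i; rewrite in_cons ip orbT => /(_ isT).
  have := appP (phi i (w (k - len p)%N)).
  have := appP (phi i (w (k - len p).+1)).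
  rewrite !ltr_distl => /andP[? ?] /andP[? ?] /andP[? ?]; apply/andP; split; lra.
Qed.

Variable c : J -> set nat.
Hypothesis c_inj : injective c.

Let resolution (p : partial_walk) : nat := sval (cid (trace_separates c_inj (coords p))).

Let shape (p : partial_walk) : nat :=
  pickle (len p, precision p, resolution p,
    [seq (trace c (resolution p) j, mkseq (entries p j) (len p)) | j <- coords p]).

(** An index common to both coordinate sets carries the same label in both, since
    [trace] is injective on each of them; so the two approximations can be
    glued.  They have the same length, hence no promise has to be kept. *)
Let shape_compatible p q : shape p = shape q -> exists2 r, ext r p & ext r q.
Proof.
move=> /(pcan_inj pickleK)[lenE precE resE mapE].
pose r := PartialWalk (len p) (coords p ++ coords q)
  (fun j => if j \in coords p then entries p j else entries q j) (precision p).
have posp j k : j \in coords p -> pos r j k = pos p j k.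
  by rewrite /pos /= => ->.
have posq j k : j \in coords q -> pos r j k = pos q j k.
  move=> jq; rewrite /pos /= lenE; case: ifP => // klt.
  case: ifP => // jp; congr ratr.
  have /(map_f (fun j => (trace c (resolution p) j, mkseq (entries p j) (len p)))) := jp.
  rewrite mapE => /mapP[i iq []]; rewrite resE => tij eij.
  have ji : j = i by move: tij; rewrite /resolution; case: cid => N /= NP /NP; apply.
  by move: (congr1 (nth 0 ^~ k) eij); rewrite lenE ji !nth_mkseq.
exists r; split => //=; rewrite -?lenE -?precE //.
- by move=> j jp; rewrite mem_cat jp.
- by move=> j k jp _; exact: posp.
- by move=> k /andP[pk]; rewrite ltnNge pk.
- by move=> j jp; rewrite mem_cat jp orbT.
- by move=> j k jp _; exact: posq.
- by move=> k /andP[pk]; rewrite ltnNge pk.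
Qed.

(** The third property comes for free: at the time [len p] of a condition [p] in
    the generic filter, all coordinates of [p] vanish. *)
Lemma generic_walk : martin_axiom -> lt_continuum [set: J] ->
  exists a : J -> nat -> R,
  [/\ forall (S : seq J) (e : R), 0 < e -> exists N, forall k, (N <= k)%N ->
        (exists x, forall j, j \in S -> `|a j k - phi j x| < e) /\
        (forall j, j \in S -> `|a j k.+1 - a j k| < e),
      forall j N, (exists y, phi j y = 1) -> exists2 k, (N <= k)%N & 2^-1 < a j k &
      forall (S : seq J) N, exists2 k, (N <= k)%N & forall j, j \in S -> a j k = 0].
Proof.
move=> MA smallJ.
have [|G [Gdir GD]] := martin_axiom_centered ext_refl ext_trans MA _ shape_compatible
  (lt_continuum_prod_nat smallJ) requirement_dense.
  by exists (PartialWalk 0 [::] (fun _ _ => 0) 0).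
(* As [G] meets all requirements, every position is decided by some [p]. *)
pose a j k := xget 0
  [set r | exists p, [/\ G p, j \in coords p, (k < len p)%N & pos p j k = r]].
have aE p j k : G p -> j \in coords p -> (k <= len p)%N -> a j k = pos p j k.
  move=> Gp jp kp; rewrite /a; case: xgetP => [_ -> [q [Gq jq kq <-]]|].
    have [r [_ [_ _ rp _] [_ _ rq _]]] := Gdir p q Gp Gq.
    by rewrite -rp // -rq // ltnW.
  have [q Gq [/= jq _ kq _]] := GD (j, k.+1) => /(_ (pos q j k)).
  by case; exists q.
have catch j S n : exists2 p, G p & [/\ {subset j :: S <= coords p},
    (n <= precision p)%N & (n <= len p)%N].
  elim: S j => [|i S IH] j.
    have [p Gp [/= jp mp lp _]] := GD (j, n).
    by exists p => //; split => // ?; rewrite inE => /eqP ->.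
  have [p Gp [ip mp lp]] := IH i; have [q Gq [/= jq _ _ _]] := GD (j, n).
  have [r [Gr [[plr pmr] pr _ _] [_ qr _ _]]] := Gdir p q Gp Gq.
  exists r => //; split; [|exact: leq_trans pmr|exact: leq_trans plr].
  by move=> j'; rewrite in_cons => /predU1P[->|/ip/pr//]; exact: qr.
exists a; split.
- move=> [|j S] e e0.
    by exists 0%N => k _; split => //; exists x0.
  have [n ne] : exists n : nat, n.+1%:R^-1 < e.
    by have [n] := ltr_add_invr e0; rewrite add0r; exists n.
  have [p Gp [Sp mp _]] := catch j S n; exists (len p) => k pk.
  have pe : eps p < e.
    by apply: le_lt_trans ne; rewrite lef_pV2 ?posrE ?ltr0n // ler_nat.
  have [q Gq [_ _ /= kq _]] := GD (j, k.+2).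
  have [r [Gr [_ pr _ close] [[qlr _] _ _ _]]] := Gdir p q Gp Gq.
  have kr : (k.+2 <= len r)%N by exact: leq_trans qlr.
  have [|[x xP] stepP] := close k; first by rewrite pk ltnW.
  split; [exists x|] => i /Sp ip; rewrite !(aE r) ?(pr i) //; try by lia.
    exact: lt_trans (xP _ ip) _.
  exact: lt_trans (stepP _ ip) _.
- move=> j N y; have [p Gp [/= jp _ _ /(_ y)[k [/andP[Nk kp] ak]]]] := GD (j, N).
  by exists k => //; rewrite (aE p) // ltnW.
- move=> [|j S] N; first by exists N.
  have [p Gp [Sp _ lp]] := catch j S N; exists (len p) => // i /Sp ip.
  by rewrite (aE p) // pos_len.
Qed.

End Generic.

(** * Piecewise linear interpolation on the half line *)

Section Clamp.
Variable R : realType.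
Implicit Types x y : R.

Definition clamp x : R := Num.max 0 (Num.min 1 x).

Lemma clamp_le0 x : x <= 0 -> clamp x = 0.
Proof. by move=> x0; rewrite /clamp min_r ?max_l //; lra. Qed.

Lemma clamp_ge1 x : 1 <= x -> clamp x = 1.
Proof. by move=> x1; rewrite /clamp min_l ?max_r //; lra. Qed.

Lemma clamp_id x : 0 <= x <= 1 -> clamp x = x.
Proof. by move=> /andP[x0 x1]; rewrite /clamp min_r ?max_r. Qed.

Lemma clamp_dist x y : 0 <= y <= 1 -> `|clamp x - y| <= `|x - y|.
Proof.
move=> /andP[y0 y1]; have [x0|x0] := lerP x 0.
  by rewrite clamp_le0 // !ler0_norm; lra.
have [x1|x1] := lerP x 1; first by rewrite clamp_id // x1 ltW.
by rewrite (clamp_ge1 (ltW x1)) // !ger0_norm; lra.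
Qed.

Lemma clamp_unit x : clamp x \in unit_interval R.
Proof.
apply/mem_set; rewrite /unit_interval /= in_itv /= /clamp.
by rewrite le_max lexx ge_max ge_min lexx ler01.
Qed.

Lemma unit_bounds (u : unit_interval R) : 0 <= val u <= 1.
Proof. by have /set_mem := valP u; rewrite /unit_interval /= in_itv. Qed.

Lemma clamp_continuous : continuous clamp.
Proof.
have -> : clamp = (fun=> 0 : R^o) \max ((fun=> 1 : R^o) \min (fun y => y : R^o)).
  by [].
move=> x.
apply: continuous_max; first exact: cvg_cst.
by apply: continuous_min; [exact: cvg_cst|exact: cvg_id].
Qed.

Lemma clamp_lift (X : topologicalType) (h : X -> R) : continuous h ->
  exists f : continuousType X (unit_interval R), forall z, val (f z) = clamp (h z).
Proof.
move=> h_cts.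
pose f z : unit_interval R :=
  exist (fun y => y \in unit_interval R) _ (clamp_unit (h z)).
have f_cts : continuous f.
  apply: (@continuous_comp_initial _ _ _ set_val f) => z.
  by apply: (@continuous_comp _ _ _ h clamp); [exact: h_cts|exact: clamp_continuous].
by exists (mkcts f_cts).
Qed.

Variable a : nat -> R.

(** The interpolation between the nodes 0 and [N], constant outside.
    As a finite sum of clamped translations it is continuous without gluing. *)
Let partial N t := a 0%N + \sum_(i < N) (a i.+1 - a i) * clamp (t - i%:R).

Let partial_continuous N : continuous (partial N).
Proof.
have term_cts (i : 'I_N) : continuous (fun t : R => (a i.+1 - a i) * clamp (t - i%:R)).
  move=> t; apply: cvgM; first exact: cvg_cst.
  apply: continuous_cvg; first exact: clamp_continuous.
  by apply: cvgB; [exact: cvg_id|exact: cvg_cst].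
have sum_cts := continuous_big (x0 := 0) (P := xpredT) (@add_continuous R)
  (r := index_enum 'I_N) (fun i _ => term_cts i).
by move=> t; apply: (cvgD (cvg_cst (a 0%N)) (sum_cts t)).
Qed.

Let partial_stable N M t : (N <= M)%N -> t <= N%:R -> partial M t = partial N t.
Proof.
move=> + tN; elim: M => [|M IH]; first by rewrite leqn0 => /eqP ->.
rewrite leq_eqVlt => /predU1P[->//|]; rewrite ltnS => NM.
rewrite -IH // /partial big_ord_recr /= clamp_le0 ?mulr0 ?addr0 //.
by rewrite subr_le0 (le_trans tN) // ler_nat.
Qed.

Let partial_nodes N t : N%:R <= t -> partial N t = a N.
Proof.
elim: N => [|N IH] Nt; first by rewrite /partial big_ord0 addr0.
have Nt' : N%:R + 1 <= t by rewrite natr1.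
rewrite /partial big_ord_recr /= clamp_ge1; last by lra.
rewrite addrA -/(partial N t) IH; lra.
Qed.

Let interpolant t := partial (Num.truncn t).+1 t.

Let interpolantE N t : t <= N%:R -> interpolant t = partial N t.
Proof.
move=> tN; rewrite /interpolant; case: (leqP (Num.truncn t).+1 N) => [NM|].
  by rewrite [RHS](partial_stable NM) // ltW // truncnS_gt.
by move=> /ltnW NM; rewrite (partial_stable NM).
Qed.

Let interpolant_continuous : continuous interpolant.
Proof.
move=> t; pose N := (Num.truncn t).+2.
have tN : t < N%:R.
  by rewrite (lt_trans (truncnS_gt t)) // ltr_nat.
rewrite /continuous_at (interpolantE (ltW tN)).
apply: cvg_trans (@partial_continuous N t).
apply: near_eq_cvg; near=> s; apply/esym/interpolantE/ltW.
by near: s; exact: lt_nbhsl.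
Unshelve. all: by end_near. Qed.

(** Only distances to points of the unit interval matter, and clamping decreases
    them; at the node [k] the bound is [`|a k - y|]. *)
Lemma piecewise_linear : exists f : continuousType (half_line R) (unit_interval R),
  forall k (t : half_line R) (y : R), k%:R <= val t <= k.+1%:R -> 0 <= y <= 1 ->
    `|val (f t) - y| <= `|a k - y| + (val t - k%:R) * `|a k.+1 - a k|.
Proof.
have [|f fE] := @clamp_lift (half_line R) (interpolant \o val).
  move=> t; apply: (@continuous_comp _ _ _ (set_val : half_line R -> R) interpolant).
    exact: initial_continuous.
  exact: interpolant_continuous.
exists f => k t y /andP[kt tk] y01; rewrite fE.
apply: le_trans (clamp_dist _ y01) _.
rewrite /= (interpolantE tk) /partial big_ord_recr /= addrA -/(partial k _).
have tk' : val t <= k%:R + 1 by rewrite natr1.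
rewrite partial_nodes // clamp_id; last by rewrite subr_ge0 kt lerBlDl.
rewrite -addrA [_ * _ - _]addrC addrA; apply: le_trans (ler_normD _ _) _.
by rewrite normrM [`|_ - k%:R|]ger0_norm ?subr_ge0 // mulrC.
Qed.

End Clamp.

(** * The remainder and its projections *)

Section RealCoordinates.
Variables (R : realType) (T : topologicalType).

(** Hausdorffness, continuity and exact coordinates of limits are all derived
    from this fact. *)
Lemma cluster_value (g : T -> R) (F : set_system T) (z : T) (c : R) :
  continuous g -> cluster F z ->
  (forall e, 0 < e -> F [set x | `|g x - c| < e]) -> g z = c.
Proof.
move=> g_cts zF Fg; apply/eqP; rewrite -subr_eq0 -normr_le0.
apply/ler_addgt0Pl => e e0; rewrite addr0.
have e2 : 0 < e / 2 by lra.
have gz : \forall x \near z, `|g z - g x| < e / 2.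
  by have /cvgr_dist_lt/(_ _ e2) := g_cts z.
have [x [/= xc xz]] := zF _ _ (Fg _ e2) gz.
have := ler_distD (g x) (g z) c; lra.
Qed.

Lemma hausdorff_separated (J : Type) (g : J -> T -> R) :
  (forall j, continuous (g j)) ->
  (forall x y, (forall j, g j x = g j y) -> x = y) -> hausdorff_space T.
Proof.
move=> g_cts g_sep p q pq; apply: g_sep => j; symmetry.
apply: (cluster_value (g_cts j) pq) => e e0.
have /cvgr_dist_lt/(_ e e0) := g_cts j p.
by apply: filterS => z; rewrite distrC.
Qed.

Variables (J : eqType) (g : J -> T -> R).
Hypothesis g_cts : forall j, continuous (g j).
Hypothesis T_compact : compact [set: T].

(** The solution is a cluster point of the filter generated by the sets of
    approximate solutions of finitely many equations.  With [T := K] this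
    provides the image of a point of the remainder; with the cube as [T] and the
    tails as [B], a preimage of a point of [K]. *)
Lemma compact_limit (B : nat -> set T) (c : J -> R) :
  (forall m n, (m <= n)%N -> B n `<=` B m) ->
  (forall (S : seq J) e n, 0 < e ->
     exists2 x, B n x & forall j, j \in S -> `|g j x - c j| < e) ->
  exists z, (forall j, g j z = c j) /\ (forall n, closure (B n) z).
Proof.
move=> B_mono B_close.
pose near_c (q : seq J * R * nat) : set T :=
  [set x | B q.2 x /\ forall j, j \in q.1.1 -> `|g j x - c j| < q.1.2].
pose F := filter_from [set q : seq J * R * nat | 0 < q.1.2] near_c.
have F_proper : ProperFilter F.
  apply: filter_from_proper.
    apply: filter_from_filter; first by exists ([::], 1, 0%N) => /=.
    move=> [[S1 e1] n1] [[S2 e2] n2] /= e10 e20.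
    exists (S1 ++ S2, Num.min e1 e2, maxn n1 n2); first by rewrite /= lt_min e10.
    move=> x [/= Bx xS]; split; split => /=.
    - exact: B_mono (leq_maxl _ _) _ Bx.
    - by move=> j jS; have := xS j; rewrite mem_cat jS lt_min => /(_ isT)/andP[].
    - exact: B_mono (leq_maxr _ _) _ Bx.
    - by move=> j jS; have := xS j; rewrite mem_cat jS orbT lt_min => /(_ isT)/andP[].
  move=> [[S e] n] /= e0; have [x Bx xS] := B_close S e n e0; by exists x.
have [z [_ zF]] := T_compact F_proper filterT.
exists z; split => [j|n].
  apply: (cluster_value (@g_cts j) zF) => e e0.
  by exists ([:: j], e, 0%N) => //= x [_ /= /(_ j)]; rewrite inE eqxx; apply.
by move=> V nV; apply: zF nV; exists ([::], 1, n) => //= x [].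
Qed.

End RealCoordinates.

Lemma prod_continuous (X : topologicalType) (I : Type) (T : I -> topologicalType)
    (f : X -> prod_topology T) :
  (forall i, continuous (fun x => f x i)) -> continuous f.
Proof.
move=> f_cts x; apply/cvg_sup => i.
apply: (@continuous_comp_initial _ _ _ (fun h : forall i, T i => h i) f) => y.
exact: f_cts.
Qed.

Section CubeCoordinates.
Variables (R : realType) (X : topologicalType).
Implicit Types g : continuousType X (unit_interval R).

Definition coordinate g (xi : cube R X) : R := val (xi g).

Lemma coordinate_continuous g : continuous (coordinate g).
Proof.
move=> xi; apply: (@continuous_comp _ _ _ (fun eta : cube R X => eta g) set_val).
  exact: (@proj_continuous _ (fun=> unit_interval R) g).
exact: initial_continuous.
Qed.

Lemma cube_hausdorff : hausdorff_space (cube R X).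
Proof.
apply: (hausdorff_separated coordinate_continuous) => xi eta xe.
by apply/funext => g; apply: val_inj; exact: xe.
Qed.

Lemma unit_interval_compact : compact [set: unit_interval R].
Proof.
have [f fE] := @clamp_lift R R id (fun x => cvg_id).
have -> : [set: unit_interval R] = f @` `[0, 1].
  apply/seteqP; split => // u _; exists (val u).
    by rewrite /= in_itv /=; exact: unit_bounds.
  by apply: val_inj; rewrite fE clamp_id // unit_bounds.
apply: continuous_compact; last exact: segment_compact.
by apply: continuous_subspaceT; exact: cts_fun.
Qed.

Lemma cube_compact : compact [set: cube R X].
Proof.
have := @tychonoff _ (fun _ : continuousType X (unit_interval R) => unit_interval R)
  (fun=> setT) (fun=> unit_interval_compact).
by congr compact; apply/seteqP; split.
Qed.

Lemma stone_cech_map_continuous : continuous (@stone_cech_map R X).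
Proof. by apply: prod_continuous => g; exact: cts_fun. Qed.

End CubeCoordinates.

Section HalfLine.
Variable R : realType.
Notation H := (half_line R).

Definition tail (n : nat) : set (cube R H) :=
  @stone_cech_map R H @` [set t | n%:R <= val t].

Lemma tail_mono m n : (m <= n)%N -> tail n `<=` tail m.
Proof.
by move=> mn _ [t tn <-]; exists t => //=; apply: le_trans tn; rewrite ler_nat.
Qed.

Lemma half_line_initial_compact (b : R) : compact [set t : H | val t <= b].
Proof.
have h_half s : Num.max 0 s \in half_line R.
  by apply/mem_set; rewrite /half_line /= in_itv /= le_max lexx.
pose h s : H := exist (fun y => y \in half_line R) _ (h_half s).
have h_cts : continuous h.
  apply: (@continuous_comp_initial _ _ _ set_val h) => s.
  by apply: (@continuous_max R _ (fun=> 0) (fun y => y : R^o));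
    [exact: cvg_cst|exact: cvg_id].
have -> : [set t : H | val t <= b] = h @` `[0, b] `&` [set t : H | val t <= b].
  apply/seteqP; split => [t /= tb|t []//]; split => //.
  have t0 : 0 <= val t.
    by have /set_mem := valP t; rewrite /half_line /= in_itv /= andbT.
  exists (val t); first by rewrite /= in_itv /= t0.
  by apply: val_inj; rewrite /= max_r.
apply: compact_closedI.
  apply: continuous_compact; last exact: segment_compact.
  exact: continuous_subspaceT.
apply: (@preimage_closed _ _ (set_val : H -> R) [set x | x <= b]).
  by move=> t _; exact: initial_continuous.
exact: closed_le.
Qed.

(** A point of the compactification outside the closure of a tail lies in the
    image of the complementary segment, which is compact and thus closed.
    Conversely the image of [t0] is not in all these closures, because the
    clamped translation by [t0] is 0 at [t0] and 1 far away. *)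
Lemma half_line_remainderE :
  stone_cech_remainder R H = \bigcap_n closure (tail n).
Proof.
apply/seteqP; split => [xi [cl_xi nxi] n _|xi tails].
  have : closure (@stone_cech_map R H @` [set t | val t <= n%:R] `|` tail n) xi.
    apply: closureS cl_xi => _ [t _ <-].
    by have [tn|/ltW tn] := lerP (val t) n%:R; [left|right]; exists t.
  rewrite closureU => -[|//].
  rewrite -(closure_id _).1 => [[t _ txi]|]; first by case: nxi; exists t.
  apply: compact_closed; first exact: cube_hausdorff.
  apply: (@continuous_compact H (cube R H) (@stone_cech_map R H));
    last exact: half_line_initial_compact.
  exact/continuous_subspaceT/stone_cech_map_continuous.
split.
  by apply: closureS (tails 0%N Logic.I) => _ [t _ <-]; exists t.
move=> [t0 _ t0xi].
have [|f fE] := @clamp_lift R H (fun t => val t - val t0).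
  move=> t; apply: (@continuous_comp H R R set_val (fun s => s - val t0)).
    exact: initial_continuous.
  by apply: cvgB; [exact: cvg_id|exact: cvg_cst].
pose n := (Num.truncn (val t0 + 1)).+1.
have f_small : \forall eta \near xi, coordinate f eta < 1.
  have : coordinate f @ xi --> coordinate f xi by exact: coordinate_continuous.
  move=> /cvgr_lt; apply.
  by rewrite -t0xi /coordinate /= fE subrr clamp_le0.
(* From [n] on the function [f] equals 1, so the tail misses this neighbourhood. *)
have [_ [[t /= nt <-] /=]] := tails n Logic.I _ f_small.
rewrite /coordinate /= fE clamp_ge1 ?ltxx //.
have := truncnS_gt (val t0 + 1); rewrite -/n => t0n.
by rewrite lerBrDl; apply/ltW/(lt_le_trans t0n).
Qed.

Variables (K : topologicalType) (J : eqType) (phi : J -> K -> R).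
Hypothesis K_compact : compact [set: K].
Hypothesis phi_cts : forall j, continuous (phi j).
Hypothesis phi_sep : forall x y, (forall j, phi j x = phi j y) -> x = y.
Variable f : J -> continuousType H (unit_interval R).

(** The image of [xi] is the point whose coordinates are those of [xi] at the
    functions [f j].  It exists since [xi] is a limit of tails, which [f] maps
    close to [K], and the preimage of [z] is a limit of points of the tails
    whose coordinates approach those of [z]. *)
Lemma remainder_onto :
  (forall (S : seq J) (e : R), 0 < e -> exists N : nat, forall t : H,
    N%:R <= val t -> exists x, forall j, j \in S -> `|val (f j t) - phi j x| < e) ->
  (forall z (S : seq J) (e : R) (N : nat), 0 < e -> exists t : H,
    N%:R <= val t /\ forall j, j \in S -> `|val (f j t) - phi j z| < e) ->
  continuous_image (half_line_remainder R) K.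
Proof.
move=> f_near f_hit.
have K_hausdorff := hausdorff_separated phi_cts phi_sep.
have /choice[F FP] (xi : half_line_remainder R) :
    exists z, forall j, phi j z = coordinate (f j) (val xi).
  have tails : (\bigcap_n closure (tail n)) (val xi).
    by rewrite -half_line_remainderE; exact: set_mem (valP xi).
  have [//|S e n e0|z [zP _]] := compact_limit phi_cts K_compact (B := fun=> setT)
    (c := fun j => coordinate (f j) (val xi)); last by exists z.
  have e2 : 0 < e / 2 by lra.
  have [N NP] := f_near S _ e2.
  have nxi := fin_close_nbhs (fun j => @coordinate_continuous _ _ (f j)) S (val xi) e2.
  have [_ [[t Nt <-] /= txi]] := tails N Logic.I _ nxi.
  have [x xP] := NP t Nt; exists x => // j jS.
  have := txi j jS; have := xP j jS; rewrite /coordinate /=.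
  rewrite !ltr_distl => /andP[? ?] /andP[? ?]; apply/andP; split; lra.
exists F; last first.
  apply/seteqP; split => // z _.
  have [//|S e n e0|xi [xiP tails]] := compact_limit
    (fun j => @coordinate_continuous _ _ (f j)) (@cube_compact R H) (B := tail)
    (c := fun j => phi j z).
  - exact: tail_mono.
  - have [t [nt tz]] := f_hit z S e n e0.
    by exists (stone_cech_map t) => //; exists t.
  have xi_rem : xi \in stone_cech_remainder R H.
    by apply/mem_set; rewrite half_line_remainderE => n _.
  exists (exist _ xi xi_rem : half_line_remainder R) => //.
  by apply: phi_sep => j; rewrite FP xiP.
(* In the compact Hausdorff space [K] it suffices for continuity that [F xi] is the
   only cluster point of the image of the neighbourhood filter of [xi]. *)
move=> xi.
have F_proper : ProperFilter (F @ xi) := fmap_proper_filter F (nbhs_pfilter xi).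
apply: (compact_cluster_set1 K_hausdorff K_compact _ F_proper); try exact: filterT.
have uniq w : cluster (F @ xi) w -> w = F xi.
  move=> cl_w; apply: phi_sep => j.
  apply: (cluster_value (@phi_cts j) cl_w) => e e0.
  have g_cts : continuous (fun eta : half_line_remainder R => coordinate (f j) (val eta)).
    move=> eta; apply: (@continuous_comp _ _ _ set_val (coordinate (f j))).
      exact: initial_continuous.
    exact: coordinate_continuous.
  have /cvgr_dist_lt/(_ e e0) := g_cts xi.
  by apply: filterS => eta /=; rewrite !FP distrC.
apply/seteqP; split => [w /uniq //|_ ->].
have [w [_ cl_w]] := K_compact F_proper filterT.
by rewrite -(uniq w).
Qed.

End HalfLine.

(** * Bump functions and the theorem *)

Lemma half_line_nat (R : realType) (n : nat) : exists t : half_line R, val t = n%:R.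
Proof.
have n_half : n%:R \in half_line R.
  by apply/mem_set; rewrite /half_line /= in_itv /= ler0n.
by exists (exist (fun y => y \in half_line R) _ n_half).
Qed.

Section Bumps.
Variables (R : realType) (K : topologicalType) (B : set (set K)) (x0 : K).
Hypothesis K_compact : compact [set: K].
Hypothesis K_hausdorff : hausdorff_space K.
Hypothesis B_basis : basis B.

(** The function of the pair (U, V) is, when the closure of V lies in U and x0
    does not, a Urysohn function that is 1 on V and 0 off U.  Points are
    separated although all functions vanish at [x0], because of two distinct
    points at least one is not [x0]. *)
Lemma bump_functions : exists phi : B * B -> K -> R,
  [/\ forall j, continuous (phi j),
      forall j x, 0 <= phi j x <= 1,
      forall j, phi j x0 = 0 &
      forall y (W : set K), y <> x0 -> nbhs y W ->
        exists j, phi j y = 1 /\ forall z, ~ W z -> phi j z = 0].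
Proof.
have /choice[phi phiP] (j : B * B) : exists h : K -> R,
    [/\ continuous h, forall x, 0 <= h x <= 1, h x0 = 0 &
      closure (val j.2) `<=` val j.1 -> ~ val j.1 x0 ->
      (forall y, val j.2 y -> h y = 1) /\ (forall z, ~ val j.1 z -> h z = 0)].
  have zero_cts : continuous (fun _ : K => 0 : R) by move=> x; exact: cvg_cst.
  have [[VU Ux0]|nVU] :=
    pselect (closure (val j.2) `<=` val j.1 /\ ~ val j.1 x0); last first.
    by exists (fun=> 0); split => // [x|? ?]; [rewrite lexx ler01|case: nVU].
  have U_open : open (val j.1) by apply: B_basis.1; exact: set_mem (valP j.1).
  have := (normal_separatorP).1 (compact_normal K_hausdorff K_compact) _ _
    (open_closedC U_open) (@closed_closure _ (val j.2)).
  have -> : ~` val j.1 `&` closure (val j.2) = set0.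
    by apply/seteqP; split => // z [nUz /VU].
  move=> /(_ R erefl)/(@uniform_separatorP _ R)[h [h_cts h01 h0 h1]].
  exists h; split => //.
  - by move=> x; have /h01 := imageT h x; rewrite /= in_itv.
  - by apply: h0; exists x0.
  - move=> _ _; split => [y Vy|z Uz]; last by apply: h0; exists z.
    by apply: h1; exists y => //; exact: subset_closure.
exists phi; split => [j|j x|j|y W yx0 Wy]; try by case: (phiP j).
have W'y : nbhs y (W `&` ~` [set x0]).
  apply: filterI => //; apply: open_nbhs_nbhs; split => //.
  exact/closed_openC/accessible_closed_set1/hausdorff_accessible.
have [U [BU Uy] UW] := B_basis.2 y _ W'y.
have U_nbhs : nbhs y U by apply: open_nbhs_nbhs; split => //; exact: B_basis.1.
have [N Ny NU] := compact_regular K_hausdorff K_compact filterT U_nbhs.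
have [V [BV Vy] VN] := B_basis.2 y _ Ny.
pose j : B * B := (exist _ U (mem_set BU), exist _ V (mem_set BV)).
have [_ _ _ [||ones zeros]] := phiP j.
- exact: subset_trans (closureS VN) NU.
- by move=> /UW[_]; apply.
by exists j; split => [|z Wz]; [exact: ones|apply: zeros => /UW[]].
Qed.

End Bumps.

Theorem theorem5p2 (R : realType) (K : topologicalType) :
  martin_axiom ->
  continuum K ->
  weight_lt_continuum K ->
  continuous_image (half_line_remainder R) K.
Proof.
move=> MA [[x0 _] K_compact K_conn K_hausdorff] [B [B_basis _] B_small].
have [phi [phi_cts phi01 phi_x0 phi_bump]] :=
  bump_functions R x0 K_compact K_hausdorff B_basis.
have phi_sep x y : (forall j, phi j x = phi j y) -> x = y.
  have sep u v : v <> x0 -> (forall j, phi j u = phi j v) -> u = v.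
    move=> vx0 uv; apply: contrapT => neq_uv.
    have nv : nbhs v (~` [set u]).
      apply: open_nbhs_nbhs; split; last by move=> /esym.
      exact/closed_openC/accessible_closed_set1/hausdorff_accessible.
    have [j [jv ju]] := phi_bump v _ vx0 nv.
    have : phi j u = 0 by apply: ju; apply.
    by rewrite uv jv => /eqP; rewrite oner_eq0.
  have [->|yx0] := pselect (y = x0); last exact: sep.
  have [->//|xx0 xy] := pselect (x = x0).
  by apply/esym/sep => // j; rewrite xy.
have J_small : lt_continuum [set: B * B].
  have B_small' : lt_continuum [set: B].
    have /card_eqPle[TB BT] := card_setT B.
    case: B_small => Bc cB; split; first exact: card_le_trans TB Bc.
    by move=> cT; apply: cB; exact: card_le_trans cT TB.
  exact: lt_continuum_prod.
have [c c_inj] := lt_continuum_inj J_small.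
have [a [a_near a_bump a_zero]] :=
  generic_walk phi_cts phi_x0 K_conn c_inj MA J_small.
have /choice[f fP] j := piecewise_linear (a j).
have f_node j (k : nat) t y : val t = k%:R -> 0 <= y <= 1 ->
    `|val (f j t) - y| <= `|a j k - y|.
  move=> tk y01; have := fP j k t y; rewrite tk subrr mul0r addr0; apply => //.
  by rewrite lexx ler_nat leqnSn.
apply: (remainder_onto K_compact phi_cts phi_sep (f := f)) => [S e e0|z S e N e0].
  have e3 : 0 < e / 3 by lra.
  have [N NP] := a_near S _ e3; exists N => t Nt.
  have t0 : 0 <= val t by apply: le_trans Nt; rewrite ler0n.
  have /andP[kt tk] := truncn_itv t0; set k := Num.truncn (val t) in kt tk.
  have Nk : (N <= k)%N by rewrite truncn_ge_nat.
  have [[x xP] stepP] := NP k Nk; exists x => j jS.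
  have tk1 : val t - k%:R <= 1 by rewrite lerBlDl natr1 ltW.
  have kt' : k%:R <= val t <= k.+1%:R by rewrite kt ltW.
  apply: le_lt_trans (fP j k t _ kt' (phi01 j x)) _.
  have := xP j jS; have := stepP j jS => stepj xj.
  have : (val t - k%:R) * `|a j k.+1 - a j k| <= `|a j k.+1 - a j k|.
    by rewrite ler_piMl.
  lra.
have [->|zx0] := pselect (z = x0).
  have [k Nk ak] := a_zero S N; have [t tk] := half_line_nat R k.
  exists t; split=> [|j jS]; first by rewrite tk ler_nat.
  by rewrite (le_lt_trans (f_node j k t _ tk (phi01 j x0))) // ak // phi_x0 subrr normr0.
have e3 : 0 < e / 3 by lra.
have [i [iz ioff]] := phi_bump z _ zx0 (fin_close_nbhs phi_cts S z e3).
have e'0 : 0 < Num.min (e / 3) 2^-1 :> R by rewrite lt_min e3; lra.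
have [N1 N1P] := a_near (i :: S) _ e'0.
have [k /[!geq_max]/andP[Nk N1k] aik] := a_bump i (maxn N N1) (ex_intro _ z iz).
have [t tk] := half_line_nat R k.
exists t; split=> [|j jS]; first by rewrite tk ler_nat.
apply: le_lt_trans (f_node j k t _ tk (phi01 j z)) _.
have [[x xP] _] := N1P k N1k.
(* Since [a i k] exceeds 1/2 and is within 1/2 of [phi i x], the point [x] lies
   in the neighbourhood of [z] off which [phi i] vanishes. *)
have xz : `|phi j x - phi j z| < e / 3.
  apply: contrapT => far; have : phi i x = 0.
    by apply: ioff => /(_ j jS).
  have := xP i (mem_head _ _); rewrite lt_min => /andP[_ +] pix.
  by rewrite pix subr0 ltr_norml => /andP[_]; lra.
have := xP j; rewrite in_cons jS orbT lt_min => /(_ isT)/andP[xj _].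
have := ler_distD (phi j x) (a j k) (phi j z); lra.
Qed.
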